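(* For every integer $n \ge 1$, the total number $A(n+2)$ of 1-ascents in all dispersed Dyck paths of length $n+2$ (i.e., the sum, over all dispersed Dyck paths of length $n+2$, of the number of 1-ascents in the path) is $$A(n+2) = 2^{n-1} + \frac{n+1}{2}\binom{n}{\lfloor n/2\rfloor}.$$
   Context: Here $\mathbb{N}=\{0,1,2,\dots\}$. A dispersed Dyck path (DDP) of length $m$ is a lattice path on $\mathbb{N}\times\mathbb{N}$ from $(0,0)$ to $(m,0)$ in which each step is one of: an up step $(x,y)\to(x+1,y+1)$; a down step $(x,y)\to(x+1,y-1)$, allowed only if $y>0$; a right step $(x,y)\to(x+1,y)$, allowed only if $y=0$. An ascent in a DDP is an inclusion-wise maximal sequence of consecutive up steps; a 1-ascent is an ascent consisting of exactly one up step. For an integer $m\ge 0$, $A(m)$ denotes the total number of 1-ascents in all DDPs of length $m$. *)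

(* Defs.v *)
From HB Require Import structures.
From mathcomp Require Import all_boot all_order all_algebra.

Set Implicit Arguments.
Unset Strict Implicit.
Unset Printing Implicit Defensive.

Inductive step : Type := Up | Down | Right.

Definition step_code (s : step) : 'I_3 :=
  match s with Up => inord 0 | Down => inord 1 | Right => inord 2 end.

Definition step_decode (i : 'I_3) : step :=
  match val i with 0 => Up | 1 => Down | _ => Right end.

Lemma step_codeK : cancel step_code step_decode.
Proof. by case; rewrite /step_decode /= inordK. Qed.

HB.instance Definition _ := Finite.copy step (can_type step_codeK).

(* [None] means that the step is not allowed at the given point. *)
Definition move (p : nat * nat) (s : step) : option (nat * nat) :=
  let: (x, y) := p in
  match s with
  | Up => Some (x.+1, y.+1)
  | Down => if 0 < y then Some (x.+1, y.-1) else None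
  | Right => if y == 0 then Some (x.+1, y) else None
  end.

Definition travel (p : nat * nat) (w : seq step) : option (nat * nat) :=
  foldl (fun q s => obind (move^~ s) q) (Some p) w.

Section Paths.

Variable m : nat.
Implicit Types (w : m.-tuple step) (I : {set 'I_m}).

(* A lattice path is encoded by its steps; the points it visits are determined
   by the starting point (0, 0). *)
Definition is_ddp w : bool := travel (0, 0) w == Some (m, 0).

Definition consecutive I : bool :=
  [forall i in I, forall j in I, forall k : 'I_m, (i <= k <= j) ==> (k \in I)].

(* A sequence of consecutive up steps is identified with the set of positions
   it occupies in [w]. *)
Definition up_run w I : bool :=
  [&& I != set0, consecutive I & [forall i in I, tnth w i == Up]].

Definition ascents w : {set {set 'I_m}} := [set I | maxset (up_run w) I].

Definition one_ascents w : {set {set 'I_m}} := [set I in ascents w | #|I| == 1].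

End Paths.

Definition A (m : nat) : nat :=
  \sum_(w : m.-tuple step | is_ddp w) #|one_ascents w|.

(* Main.v *)
Require Import Defs.
From mathcomp Require Import all_boot all_order all_algebra.
From mathcomp Require Import zify ring.

(** Only the height of a path matters for being a DDP, and besides an up step
    there is exactly one way to leave height [y]: down if [0 < y], right if
    [y = 0].  In both cases the new height is [y.-1], so a path is governed by
    the same two-term recursion at all heights.

    A 1-ascent of a path that ends at height 0 is an up step followed by a
    down step and not preceded by an up step: a factor [Up Down] that is not
    the end of a factor [Up Up Down].  Erasing [Up Down] from a path of length
    [n + 2] leaves a path of length [n]; it can be put back at [n + 1] places,
    and it makes a factor [Up Up Down] exactly when it is put back after an up
    step.  With [D] paths of length [n] from height [y] down to 0, having [U]
    up steps and [R] right steps in total, the number of 1-ascents is therefore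
    [(n + 1) D - U].  Each of these paths has [y] more down steps than up steps,
    so [2 U = (n - y) D - R], and twice the number of 1-ascents is
    [(n + 2 + y) D + R].  The lemma [double_sum_one_ascents] proves this by
    induction on [n].

    At [y = 0] it remains to see that [D] is the central binomial coefficient
    ([num_pathsE], by a reflection) and that [D + R = 2 ^ n]
    ([sum_rights_ground], where the left side is shown to double with [n]). *)

Set Implicit Arguments.
Unset Strict Implicit.
Unset Printing Implicit Defensive.

(** * Paths seen through their heights *)

(** The step is the only one other than [Up] allowed at height [y]; it leads
    to height [y.-1], also when [y = 0]. *)
Definition non_up (y : nat) : step := if y == 0 then Right else Down.

Fixpoint descends (y : nat) (w : seq step) : bool :=
  match w with
  | [::] => y == 0
  | Up :: w' => descends y.+1 w'
  | Down :: w' => (0 < y) && descends y.-1 w'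
  | Right :: w' => (y == 0) && descends y.-1 w'
  end.

Definition path_sum (f : seq step -> nat) (m y : nat) : nat :=
  \sum_(w : m.-tuple step | descends y w) f w.

Lemma travelE x y w :
  (travel (x, y) w == Some (x + size w, 0)) = descends y w.
Proof.
have stuck v : foldl (fun q s => obind (Defs.move^~ s) q) None v = None.
  by elim: v.
elim: w x y => [|s w IHw] x y.
  by rewrite /travel /= addn0; apply/eqP/eqP => [[->]|->].
rewrite /travel /= -addSnnS; case: s => /=; first exact: IHw.
- by case: y => [|y] /=; [rewrite stuck | exact: IHw].
- by case: y => [|y] /=; [exact: IHw | rewrite stuck].
Qed.

Lemma sum_step (F : step -> nat) : \sum_s F s = F Up + F Down + F Right.
Proof.
have DU : Down != Up by apply/eqP.
have RU : Right != Up by apply/eqP.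
have RD : Right != Down by apply/eqP.
rewrite (bigD1 Up) ?inE //= (bigD1 Down) //= (bigD1 Right) ?RU ?RD //=.
rewrite big1 ?addn0 ?addnA // => s /andP[/andP[/eqP s_up /eqP s_down] /eqP].
by case: s s_up s_down.
Qed.

Lemma sum_tuple_cons m (P : pred (seq step)) (f : seq step -> nat) :
  \sum_(w : m.+1.-tuple step | P w) f w =
  \sum_s \sum_(w : m.-tuple step | P (s :: w)) f (s :: w).
Proof.
rewrite pair_big_dep /=.
rewrite (reindex (fun p : step * m.-tuple step => [tuple of p.1 :: p.2])) //=.
exists (fun w : m.+1.-tuple step => (thead w, behead_tuple w)).
  by case=> s w _; congr pair; apply: val_inj.
by move=> w _; rewrite [RHS]tuple_eta.
Qed.

Lemma path_sum0 f y : path_sum f 0 y = (y == 0) * f [::].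
Proof.
rewrite /path_sum big_mkcond (big_pred1 [tuple]) => [|w].
  by rewrite /=; case: eqP => _; rewrite ?mul1n.
by rewrite [w]tuple0 /= eqxx.
Qed.

Lemma path_sumS f m y :
  path_sum f m.+1 y =
  path_sum (f \o cons Up) m y.+1 + path_sum (f \o cons (non_up y)) m y.-1.
Proof.
rewrite /path_sum (sum_tuple_cons m (descends y)) sum_step.
by case: y => [|y] /=; rewrite big_pred0_eq ?addn0.
Qed.

Lemma eq_path_sum f g m y :
  (forall w, size w = m -> f w = g w) -> path_sum f m y = path_sum g m y.
Proof. by move=> fg; apply: eq_bigr => w _; rewrite fg ?size_tuple. Qed.

Lemma path_sumD f g m y :
  path_sum (fun w => f w + g w) m y = path_sum f m y + path_sum g m y.
Proof. exact: big_split. Qed.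

Lemma path_sum_eq0 f m y : (forall w, f w = 0) -> path_sum f m y = 0.
Proof. by move=> f0; apply: big1. Qed.

(** * Numbers of paths and of right steps *)

Definition num_paths : nat -> nat -> nat := path_sum (fun=> 1).

Definition is_right (s : step) : bool := if s is Right then true else false.

Definition sum_rights : nat -> nat -> nat := path_sum (count is_right).

Lemma num_paths0 y : num_paths 0 y = (y == 0).
Proof. by rewrite /num_paths path_sum0 muln1. Qed.

Lemma num_pathsS m y :
  num_paths m.+1 y = num_paths m y.+1 + num_paths m y.-1.
Proof. exact: path_sumS. Qed.

Lemma sum_rights0 y : sum_rights 0 y = 0.
Proof. by rewrite /sum_rights path_sum0 muln0. Qed.

Lemma sum_rightsS m y :
  sum_rights m.+1 y =
  sum_rights m y.+1 + sum_rights m y.-1 + (y == 0) * num_paths m 0.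
Proof.
rewrite /sum_rights path_sumS -addnA; congr (_ + _).
case: y => [|y] /=; last by rewrite addn0.
rewrite mul1n /num_paths -path_sumD.
by apply: eq_path_sum => w _ /=; rewrite addnC.
Qed.

(** Replacing the steps [Right] by down steps and reflecting below height 0
    turns the recursion into that of free walks with steps [1] and [-1], so
    that this is the number of walks of length [m] from [y] to [{0, -1}];
    parity selects one of the two end points. *)
Lemma num_pathsE m y : num_paths m y = 'C(m, (m + y).+1./2).
Proof.
elim: m y => [|m IHm] y; first by rewrite num_paths0; case: y => [|[|y]].
rewrite num_pathsS !IHm; case: y => [|y] /=.
  rewrite addn1 !addn0 /= binS; congr (_ + _).
  rewrite -[RHS]bin_sub; last by lia.
  by congr binomial; lia.
by rewrite !addnS /= binS.
Qed.

(** In terms of free walks, [sum_rights m y] counts the walks of length [m]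
    from [y] that end below 0 plus those that end below [-1]; raising the
    starting point by one loses the walks that end at [-1] or [-2]. *)
Lemma sum_rights_succ m y :
  sum_rights m y = sum_rights m y.+1 + num_paths m y.+1.
Proof.
elim: m y => [|m IHm] y; first by rewrite !sum_rights0 num_paths0.
rewrite !sum_rightsS num_pathsS /= (IHm y.+1).
case: y => [|y] /=; first by rewrite mul1n; lia.
by rewrite (IHm y); lia.
Qed.

Lemma sum_rights_ground m : sum_rights m 0 + num_paths m 0 = 2 ^ m.
Proof.
elim: m => [|m IHm]; first by rewrite sum_rights0 num_paths0.
rewrite expnS -IHm sum_rightsS num_pathsS /= mul1n.
by have := sum_rights_succ m 0; lia.
Qed.

(** * Numbers of 1-ascents *)

Definition is_up (s : step) : bool := if s is Up then true else false.

(** The step [s] precedes the path [w].  Outside the path the default step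
    [Right] behaves as the absence of an up step. *)
Definition one_ascent_at (s : step) (w : seq step) (i : nat) : bool :=
  [&& ~~ is_up (nth Right (s :: w) i), is_up (nth Right w i)
    & ~~ is_up (nth Right w i.+1)].

Definition num_one_ascents (s : step) (w : seq step) : nat :=
  \sum_(i < size w) one_ascent_at s w i.

Lemma num_one_ascents_cons s t w :
  num_one_ascents s (t :: w) = one_ascent_at s (t :: w) 0 + num_one_ascents t w.
Proof. by rewrite /num_one_ascents big_ord_recl. Qed.

Lemma num_one_ascents_after_up w :
  num_one_ascents Right w =
  num_one_ascents Up w + (is_up (nth Right w 0) && ~~ is_up (nth Right w 1)).
Proof.
case: w => [|t w]; first by rewrite /num_one_ascents !big_ord0.
by rewrite !num_one_ascents_cons /one_ascent_at /= addnC.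
Qed.

Definition sum_one_ascents : nat -> nat -> nat :=
  path_sum (num_one_ascents Right).

Lemma path_sum_starts_non_up m y :
  path_sum (fun w => ~~ is_up (nth Right w 0)) m.+1 y = num_paths m y.-1.
Proof.
rewrite path_sumS path_sum_eq0 //= add0n.
by apply: eq_path_sum => w _ /=; case: y.
Qed.

Lemma path_sum_starts_up_non_up m y :
  path_sum (fun w => is_up (nth Right w 0) && ~~ is_up (nth Right w 1)) m.+2 y =
  num_paths m y.
Proof.
rewrite path_sumS [X in _ + X]path_sum_eq0 ?addn0; last by case: y.
exact: path_sum_starts_non_up.
Qed.

(** A new first step [Up] makes a 1-ascent when the path continues with
    [non_up], and destroys the one at its beginning when the path begins with
    [Up] followed by [non_up]; in the balance, one 1-ascent is gained for each
    of the paths of length [m] from height [y.-1]. *)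
Lemma sum_one_ascentsS m y :
  sum_one_ascents m.+3 y =
  sum_one_ascents m.+2 y.+1 + sum_one_ascents m.+2 y.-1 + num_paths m y.-1.
Proof.
rewrite /sum_one_ascents path_sumS.
have -> : path_sum (num_one_ascents Right \o cons (non_up y)) m.+2 y.-1 =
          path_sum (num_one_ascents Right) m.+2 y.-1.
  apply: eq_path_sum => w _ /=.
  rewrite num_one_ascents_cons; case: y => [|y] //=.
  (* A leading down step is as good as a leading [Right]. *)
  by case: w => [|t w]; rewrite /num_one_ascents ?big_ord0 // !big_ord_recl.
have -> : path_sum (num_one_ascents Right \o cons Up) m.+2 y.+1 =
          num_paths m.+1 y + path_sum (num_one_ascents Up) m.+2 y.+1.
  rewrite -(path_sum_starts_non_up m.+1 y.+1) -path_sumD.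
  by apply: eq_path_sum => w _; rewrite /= num_one_ascents_cons.
have -> : path_sum (num_one_ascents Right) m.+2 y.+1 =
          path_sum (num_one_ascents Up) m.+2 y.+1 + num_paths m y.+1.
  rewrite -path_sum_starts_up_non_up -path_sumD.
  by apply: eq_path_sum => w _; rewrite num_one_ascents_after_up.
by rewrite num_pathsS; lia.
Qed.

Lemma sum_one_ascents2 y : sum_one_ascents 2 y = (y == 0).
Proof.
rewrite /sum_one_ascents !path_sumS !path_sum0.
by case: y => [|[|[|y]]] //=; rewrite /num_one_ascents /= !big_ord_recl !big_ord0.
Qed.

Lemma double_sum_one_ascents n y :
  2 * sum_one_ascents n.+2 y = (n + 2 + y) * num_paths n y + sum_rights n y.
Proof.
elim: n y => [|n IHn] y.
  rewrite sum_one_ascents2 num_paths0 sum_rights0.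
  by case: y => [|y] //=; rewrite !muln0.
rewrite sum_one_ascentsS !mulnDr !IHn num_pathsS sum_rightsS.
by case: y => [|y] /=; rewrite ?mul1n; lia.
Qed.

(** * Maximal runs of length one *)

(** A larger run around [i] contains a neighbour of [i] by consecutivity, and
    an up step next to [i] forms a larger run together with [i]. *)
Lemma maxset_up_run_set1 m (w : m.-tuple step) (i : 'I_m) :
  maxset (up_run w) [set i] = one_ascent_at Right w i.
Proof.
have upE (k : 'I_m) : (tnth w k == Up) = is_up (nth Right w k).
  by rewrite (tnth_nth Right); apply/eqP/idP => [->//|]; case: (nth _ _ _).
have runE (J : {set 'I_m}) : up_run w J =
    [&& J != set0, consecutive J & [forall k in J, is_up (nth Right w k)]].
  by congr [&& _, _ & _]; apply: eq_forallb => k; rewrite upE.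
have up_lt k : is_up (nth Right w k) -> k < m.
  by rewrite -{2}(size_tuple w); case: ltnP => // w_k; rewrite nth_default.
have run_pair (j k : 'I_m) : k = j.+1 :> nat -> is_up (nth Right w j) ->
    is_up (nth Right w k) -> up_run w [set j; k].
  move=> jk up_j up_k; rewrite runE; apply/and3P; split.
  - by apply/set0Pn; exists j; rewrite !inE eqxx.
  - apply/forall_inP => a; rewrite !inE => a_jk.
    apply/forall_inP => b; rewrite !inE => b_jk.
    apply/forallP => c; apply/implyP; rewrite !inE -!val_eqE /= jk.
    by move: a_jk b_jk; rewrite -!val_eqE /= jk; lia.
  - by apply/forall_inP => a; rewrite !inE => /orP[] /eqP->.
apply/maxsetP/and3P => [[run_i max_i]|[prev_i up_i next_i]].
  have up_i : is_up (nth Right w i).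
    by move: run_i; rewrite runE => /and3P[_ _ /forall_inP]; apply; rewrite inE.
  split=> //; apply/negP.
    case i_eq: (val i) => [|k] //= up_k.
    have k_m := up_lt _ up_k; pose j := Ordinal k_m.
    have /max_i: up_run w [set j; i] by apply: run_pair.
    rewrite sub1set !inE eqxx orbT => /(_ isT) /setP/(_ j).
    by rewrite !inE eqxx -val_eqE /= i_eq; lia.
  move=> up_k.
  have k_m := up_lt _ up_k; pose j := Ordinal k_m.
  have /max_i: up_run w [set i; j] by apply: run_pair.
  rewrite sub1set !inE eqxx => /(_ isT) /setP/(_ j).
  by rewrite !inE eqxx orbT -val_eqE /=; lia.
split=> [|J].
  rewrite runE; apply/and3P; split.
  - by apply/set0Pn; exists i; rewrite inE.
  - apply/forall_inP => a /set1P->; apply/forall_inP => b /set1P->.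
    by apply/forallP => c; apply/implyP; rewrite inE -val_eqE /=; lia.
  - by apply/forall_inP => a /set1P->.
rewrite runE sub1set => /and3P[_ /forall_inP cons_J /forall_inP up_J] i_J.
apply/setP => j; rewrite inE; apply/idP/eqP => [j_J|->//]; apply: val_inj => /=.
have between (a b c : 'I_m) : a \in J -> b \in J -> a <= c <= b -> c \in J.
  move=> a_J b_J acb; have /forall_inP/(_ b b_J) := cons_J a a_J.
  by move/forallP/(_ c)/implyP; apply.
case: (ltngtP j i) => // [ji|ij].
  have k_m : i.-1 < m by have := ltn_ord i; lia.
  have /up_J /= : Ordinal k_m \in J by apply: (between j i) => //=; lia.
  by move: prev_i ji; case: (val i) => //= k /negPf ->.
have k_m : i.+1 < m by have := ltn_ord j; lia.
have /up_J /= : Ordinal k_m \in J by apply: (between i j) => //=; lia.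
by rewrite (negPf next_i).
Qed.

Lemma card_one_ascents m (w : m.-tuple step) :
  #|one_ascents w| = num_one_ascents Right w.
Proof.
have -> : one_ascents w = set1 @: [set i : 'I_m | one_ascent_at Right w i].
  apply/setP => I; rewrite !inE; apply/andP/imsetP => [[max_I /cards1P[i I_i]]|].
    by exists i => //; rewrite inE -maxset_up_run_set1 -I_i.
  by case=> i; rewrite inE => i_asc ->; rewrite maxset_up_run_set1 cards1.
rewrite card_imset; last exact: set1_inj.
rewrite -sum1dep_card big_mkcond /num_one_ascents size_tuple.
by apply: eq_bigr => i _; case: one_ascent_at.
Qed.

(** * The total number of 1-ascents *)

Lemma A_sum_one_ascents m : A m = sum_one_ascents m 0.
Proof.
rewrite /A /sum_one_ascents /path_sum; apply: eq_big => [w|w _].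
  by rewrite /is_ddp -(travelE 0) size_tuple.
exact: card_one_ascents.
Qed.

Lemma double_A n : 2 * A n.+2 = 2 ^ n + n.+1 * 'C(n, n./2).
Proof.
rewrite A_sum_one_ascents double_sum_one_ascents -sum_rights_ground.
have -> : num_paths n 0 = 'C(n, n./2).
  by rewrite num_pathsE -bin_sub; [congr binomial|]; lia.
by lia.
Qed.

Import GRing.Theory.
Local Open Scope ring_scope.

Theorem theorem1 (n : nat) (hn : (1 <= n)%N) :
  (A (n + 2))%:R = 2 ^+ (n - 1)%N + (n + 1)%:R / 2 * 'C(n, n %/ 2)%:R :> rat.
Proof.
have /(congr1 (fun k => k%:R : rat)) := double_A n.
rewrite addn2 addn1 divn2; case: n hn => // n _.
rewrite subn1 expnS natrD !natrM natrX /= => eq2A.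
have two_neq0 : 2%:R != 0 :> rat by [].
apply: (mulfI two_neq0); rewrite eq2A; by field.
Qed.
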